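(* (i) For all integers $k\ge 0$, $n\ge 1$: $$B_{n,k}=1+\sum_{i=1}^{k}\binom{k}{i}C_{n,i}=\sum_{i=0}^{k}\binom{k}{i}C_{n,i}.$$ (ii) For all integers $k\ge 1$, $n\ge 1$: $$C_{n,k}=\sum_{i=1}^{n}\binom{n}{i}D_{i,k}.$$ (iii) For all integers $k\ge 1$, $n\ge 1$: $$B_{n,k}=1+\sum_{i=1}^{n}\sum_{j=1}^{k}\binom{n}{i}\binom{k}{j}D_{i,j}.$$
   Context: A $01$ matrix is lonesum if it is uniquely determined among $01$ matrices of its size by its row sum vector and column sum vector; equivalently (Ryser), no $2\times 2$ submatrix (obtained by deleting rows and columns) equals $\begin{pmatrix}1&0\\0&1\end{pmatrix}$ or $\begin{pmatrix}0&1\\1&0\end{pmatrix}$. Empty matrices (with $0$ rows or $0$ columns) count as lonesum. $B_{n,k}$ is the poly-Bernoulli number $B_n^{(-k)}$, defined by $\sum_{n\ge0}B_n^{(-k)}\frac{x^n}{n!}=\frac{Li_{-k}(1-e^{-x})}{1-e^{-x}}$ with $Li_{-k}(z)=\sum_{i\ge1}i^k z^i$; equivalently (Brewbaker), $B_{n,k}$ is the number of lonesum $01$ matrices of size $n\times k$. $C_{n,k}$ is the number of lonesum $01$ matrices of size $n\times k$ in which every column contains at least one $1$. $D_{n,k}$ is the number of lonesum $01$ matrices of size $n\times k$ in which every column and every row contains at least one $1$. *)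

(* Defs.v *)
From mathcomp Require Import all_boot all_order all_algebra.
Set Implicit Arguments.
Unset Strict Implicit.
Unset Printing Implicit Defensive.
Import GRing.Theory Num.Theory.
Local Open Scope ring_scope.

(* 01 matrices are boolean matrices; the dimensions may be 0.                 *)
Definition row_sums n k (A : 'M[bool]_(n, k)) : 'cV[nat]_n :=
  \col_i (\sum_j nat_of_bool (A i j))%N.

Definition col_sums n k (A : 'M[bool]_(n, k)) : 'rV[nat]_k :=
  \row_j (\sum_i nat_of_bool (A i j))%N.

Definition lonesum n k (A : 'M[bool]_(n, k)) : bool :=
  [forall A' : 'M[bool]_(n, k),
    (row_sums A' == row_sums A) && (col_sums A' == col_sums A) ==> (A' == A)].

Definition lonesumC (n k : nat) : nat :=
  #|[set A : 'M[bool]_(n, k) | lonesum A && [forall j, exists i, A i j]]|.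

Definition lonesumD (n k : nat) : nat :=
  #|[set A : 'M[bool]_(n, k) |
      [&& lonesum A, [forall j, exists i, A i j] & [forall i, exists j, A i j]]]|.

(* Formal power series over rat, as coefficient sequences.                    *)
Definition fps := nat -> rat.

Definition fps_one : fps := fun n => (n == 0)%:R.

Definition fps_mul (f g : fps) : fps :=
  fun n => \sum_(i < n.+1) f i * g (n - i)%N.

Definition fps_exp (f : fps) (m : nat) : fps := iter m (fps_mul f) fps_one.

(* The composite f(g(x)), meaningful when g has zero constant term: then      *)
(* g ^ i has no terms of degree less than i, so the sum may stop at i = n.    *)
Definition fps_comp (f g : fps) : fps :=
  fun n => \sum_(i < n.+1) f i * fps_exp g i n.

(* Li_{-k}(z) = \sum_(i >= 1) i^k z^i; no constant term, even when k = 0.     *)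
Definition polylog_neg (k : nat) : fps :=
  fun i => if i is 0 then 0 else (i ^ k)%:R.

(* 1 - e^{-x} = - \sum_(i >= 1) (-1)^i x^i / i!                               *)
Definition one_sub_expN : fps :=
  fun i => if i is 0 then 0 else - ((-1) ^+ i / (i`!)%:R).

Definition egf (b : nat -> rat) : fps := fun n => b n / (n`!)%:R.

(* B n k = B_n^{(-k)}.  Since 1 - e^{-x} has zero constant term, the quotient *)
(* Li_{-k}(1 - e^{-x}) / (1 - e^{-x}) is expressed by clearing denominators;  *)
(* exactly one B satisfies this, by the last two lemmas below.                *)
Definition is_poly_bernoulli (B : nat -> nat -> rat) : Prop :=
  forall k, fps_mul (egf (B^~ k)) one_sub_expN
            =1 fps_comp (polylog_neg k) one_sub_expN.

Lemma fps_exp_lt (g : fps) m n : g 0 = 0 -> (n < m)%N -> fps_exp g m n = 0.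
Proof.
move=> g0; elim: m n => // m IH n lt_nm.
rewrite /fps_exp iterS -/(fps_exp g m) /fps_mul big1 // => -[[|i] lt_i] _ /=.
  by rewrite g0 mul0r.
by rewrite IH ?mulr0 //; move: lt_i lt_nm; rewrite !ltnS; case: n => // n;
  rewrite subSS => _ lt_nm; apply: leq_ltn_trans lt_nm; rewrite leq_subr.
Qed.

Lemma fps_mulC (f g : fps) : fps_mul f g =1 fps_mul g f.
Proof.
move=> n; rewrite /fps_mul (reindex_inj rev_ord_inj) /=.
by apply: eq_bigr => i _; rewrite mulrC subSS subKn // -ltnS.
Qed.

Lemma poly_bernoulli_exists : exists B, is_poly_bernoulli B.
Proof.
pose u := one_sub_expN.
exists (fun n k => n`!%:R * fps_comp (fun i => (i.+1 ^ k)%:R) u n) => k n.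
pose h i : rat := (i.+1 ^ k)%:R.
have trunc m a : (a <= m)%N ->
    fps_comp h u a = \sum_(i < m.+1) h i * fps_exp u i a.
  move=> le_am; rewrite /fps_comp.
  rewrite (big_ord_widen m.+1 (fun i => h i * fps_exp u i a)) //.
  rewrite big_mkcond; apply: eq_bigr => i _; rewrite ltnS; case: leqP => // lt_ai.
  by rewrite fps_exp_lt ?mulr0.
have -> : fps_mul (egf (fun a => a`!%:R * fps_comp h u a)) u n =
    \sum_(a < n.+1) \sum_(i < n.+1) h i * (fps_exp u i a * u (n - a)%N).
  apply: eq_bigr => a _; rewrite /egf (mulrC a`!%:R) mulfK; last first.
    by rewrite pnatr_eq0 -lt0n fact_gt0.
  rewrite (trunc n) -1?ltnS // mulr_suml.
  by apply: eq_bigr => i _; rewrite mulrA.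
rewrite exchange_big /=.
under eq_bigr => i _ do rewrite -mulr_sumr -/(fps_mul _ _ n) fps_mulC.
rewrite /fps_comp [RHS]big_ord_recl mul0r add0r big_ord_recr /=.
rewrite (_ : fps_mul u _ n = 0) ?mulr0 ?addr0; last exact: (@fps_exp_lt u n.+1).
by apply: eq_bigr => i _.
Qed.

Lemma poly_bernoulli_unique (B B' : nat -> nat -> rat) :
  is_poly_bernoulli B -> is_poly_bernoulli B' -> B =2 B'.
Proof.
move=> hB hB' n k; elim/ltn_ind: n => n IH.
have:= etrans (hB k n.+1) (esym (hB' k n.+1)).
rewrite /fps_mul !big_ord_recr /= subnn !mulr0 !addr0 subSnn.
under eq_bigr => i _ do rewrite /egf IH //.
move/addrI; rewrite (_ : one_sub_expN 1 = 1) ?mulr1 //.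
by apply: mulIf; rewrite invr_eq0 pnatr_eq0 -lt0n fact_gt0.
Qed.

(* Main.v *)
Require Import Defs.
From mathcomp Require Import all_boot all_order all_fingroup all_algebra.
From mathcomp Require Import ring zify.
Import GRing.Theory.
Local Open Scope ring_scope.

(** Deleting the zero columns of a matrix changes neither its being lonesum nor
    its having zero rows, and a lonesum matrix is recovered from what remains
    and from the positions of the deleted columns.  Sorting by the set of
    nonzero columns thus gives
      #{lonesum n x k} = sum_j C(k, j) C_{n,j}    (card_lonesum_by_cols),
    and the same argument applied to the rows of the matrices counted by
    C_{n,k} gives C_{n,k} = sum_i C(n, i) D_{i,k}    (lonesumC_sum).

    What remains is that B_{n,k} is the same binomial sum of the C_{n,j}, with
    B_{n,k} given by its generating function.  Put u = 1 - e^{-x}.  Dividing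
    Li_{-k}(u) by u gives B_{n,k} = n! [x^n] sum_i (i + 1)^k u^i, and expanding
    (i + 1)^k reduces the claim to C_{n,k} = n! [x^n] sum_i i^k u^i, the moment
    of order k (poly_bernoulli_moment).  The two sides satisfy recurrences of
    different shapes:

    - the moments satisfy M_{n+1,k} = sum_(j <= k) C(k+1, j) M_{n,j}, because
      u' = 1 - u  (moment_rec);
    - the counts satisfy C_{n+1,k} = sum_(j <= n) C(n+1, j) C_{k,j}.  The rows of
      a lonesum matrix are comparable for inclusion, so that, with at least one
      row, there is no zero column exactly when some row is full; taking
      complements and transposing, C_{n+1,k} counts the lonesum k x (n+1)
      matrices with a zero column (lonesumC_rec).

    Both recurrences determine their solution from the values at n = 0.  The
    closed form T_{n,k} = sum_m c(n, m) s(k, m) solves both, where s(k, m)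
    counts the surjections from a k-set onto an m-set and c(n, m) the chains of
    m distinct nonempty subsets of an n-set: either right-hand side becomes
    sum_m (m + 1) c(n, m) c(k, m), which is symmetric in n and k
    (sum_bin_chain_sum, chain_sumS, chain_sum_sym). *)

(** * Symmetries of lonesum matrices *)

Lemma lonesumP {n k} (A : 'M[bool]_(n, k)) :
  reflect (forall A', row_sums A' = row_sums A -> col_sums A' = col_sums A ->
             A' = A)
          (lonesum A).
Proof.
apply: (iffP forallP) => [loneA A' rowE colE | uniqA A'].
  by apply/eqP/(implyP (loneA A')); rewrite rowE colE !eqxx.
by apply/implyP => /andP[/eqP rowE /eqP colE]; apply/eqP/uniqA.
Qed.

Lemma row_sums_tr {n k} (A : 'M[bool]_(n, k)) : row_sums A^T = (col_sums A)^T.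
Proof.
by apply/matrixP => i j; rewrite !mxE; apply: eq_bigr => l _; rewrite mxE.
Qed.

Lemma col_sums_tr {n k} (A : 'M[bool]_(n, k)) : col_sums A^T = (row_sums A)^T.
Proof. by rewrite -[A in RHS]trmxK row_sums_tr trmxK. Qed.

Lemma lonesum_tr {n k} (A : 'M[bool]_(n, k)) : lonesum A^T = lonesum A.
Proof.
have lonesumT m l (M : 'M[bool]_(m, l)) : lonesum M -> lonesum M^T.
  move=> /lonesumP uniqM; apply/lonesumP => M' rowE colE.
  apply: trmx_inj; rewrite trmxK; apply: uniqM.
    by rewrite row_sums_tr colE col_sums_tr trmxK.
  by rewrite col_sums_tr rowE row_sums_tr trmxK.
by apply/idP/idP => /lonesumT; rewrite ?trmxK.
Qed.

Definition compl_mx {n k} (A : 'M[bool]_(n, k)) : 'M[bool]_(n, k) :=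
  map_mx negb A.

Lemma compl_mxK {n k} : involutive (@compl_mx n k).
Proof. by move=> A; apply/matrixP => i j; rewrite !mxE negbK. Qed.

Lemma compl_mx_tr {n k} (A : 'M[bool]_(n, k)) : (compl_mx A)^T = compl_mx A^T.
Proof. by apply/matrixP => i j; rewrite !mxE. Qed.

Lemma row_sums_compl {n k} (A : 'M[bool]_(n, k)) :
  row_sums (compl_mx A) = \col_i (k - row_sums A i 0%R)%N.
Proof.
apply/matrixP => i j; rewrite !mxE.
have: (\sum_j' (compl_mx A i j' + A i j') = k)%N.
  under eq_bigr => j' _ do rewrite mxE addn_negb.
  by rewrite sum1_card card_ord.
by rewrite big_split /= => /(congr1 (subn^~ (\sum_j' A i j')%N)); rewrite addnK.
Qed.

Lemma lonesum_compl {n k} (A : 'M[bool]_(n, k)) :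
  lonesum (compl_mx A) = lonesum A.
Proof.
have lonesumN (M : 'M[bool]_(n, k)) : lonesum M -> lonesum (compl_mx M).
  move=> /lonesumP uniqM; apply/lonesumP => M' rowE colE.
  apply: (can_inj compl_mxK); rewrite compl_mxK; apply: uniqM.
    by rewrite row_sums_compl rowE -row_sums_compl compl_mxK.
  apply: trmx_inj; rewrite -!row_sums_tr compl_mx_tr row_sums_compl.
  by rewrite row_sums_tr colE -row_sums_tr -row_sums_compl -compl_mx_tr compl_mxK.
by apply/idP/idP => /lonesumN; rewrite ?compl_mxK.
Qed.

(** Ryser's obstruction: if the submatrix on rows i, i' and columns j, j' were
    the identity, exchanging its columns would preserve all row and column
    sums. *)
Lemma lonesum_switch {n k} {A : 'M[bool]_(n, k)} i i' j j' :
  lonesum A -> A i j -> A i' j' -> A i j' || A i' j.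
Proof.
move=> /lonesumP uniqA Aij Ai'j'; apply: contraT.
rewrite negb_or => /andP[nAij' nAi'j].
pose A' := \matrix_(r, c) A r (if r \in pred2 i i' then tperm j j' c else c).
suff /matrixP/(_ i j) : A' = A.
  by rewrite mxE inE eqxx tpermL Aij (negPf nAij').
apply: uniqA; apply/matrixP => r c; rewrite !mxE.
  under eq_bigr => l _ do rewrite mxE.
  case: (r \in _) => //.
  by rewrite [RHS](reindex_inj (@perm_inj _ (tperm j j'))).
(* On columns j and j' exchanging the columns of the 2 x 2 identity has the same
   effect as exchanging its rows, so the column sum is permuted by tperm i i'. *)
pose s : 'S_n := if c \in pred2 j j' then tperm i i' else 1%g.
rewrite [RHS](reindex_inj (@perm_inj _ s)) /s.
apply: eq_bigr => l _; rewrite mxE !inE.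
case: (tpermP j j' c) => [->|->|/eqP/negPf-> /eqP/negPf->]; rewrite ?eqxx ?orbT /=.
- case: (tpermP i i' l) => [->|->|/eqP/negPf-> /eqP/negPf->] //=;
    by rewrite eqxx ?orbT ?Aij ?Ai'j' ?(negPf nAij') ?(negPf nAi'j).
- case: (tpermP i i' l) => [->|->|/eqP/negPf-> /eqP/negPf->] //=;
    by rewrite eqxx ?orbT ?Aij ?Ai'j' ?(negPf nAij') ?(negPf nAi'j).
- by rewrite perm1 if_same.
Qed.

Definition no_zero_col {n k} (A : 'M[bool]_(n, k)) : bool :=
  [forall j, exists i, A i j].

(** A row of maximal weight is full: if it missed column j, some other row with
    a 1 in column j would, by comparability, contain it strictly.  A full row is
    a zero column of the transposed complement. *)
Lemma no_zero_col_compl {n k} (A : 'M[bool]_(n.+1, k)) :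
  lonesum A -> no_zero_col A = ~~ no_zero_col (compl_mx A)^T.
Proof.
move=> loneA; apply/idP/idP => [/forallP colA | /forallPn[i /existsPn fullA]].
2: by apply/forallP => j; apply/existsP; exists i; have:= fullA j; rewrite !mxE negbK.
pose w i := (\sum_j A i j)%N.
pose i := [arg max_(r > 0%R) w r]%N; apply/forallPn; exists i.
apply/existsPn => j; rewrite !mxE negbK.
have w_max r : (w r <= w i)%N by rewrite /i; case: arg_maxnP => // s _; apply.
have /existsP[i' Ai'j] := colA j; apply: contraT => nAij.
have: (w i < w i')%N; last by rewrite ltnNge w_max.
rewrite /w (bigD1 j) //= [ltnRHS](bigD1 j) //= Ai'j (negPf nAij) add0n add1n ltnS.
apply: leq_sum => l _; case Ail: (A i l) => //.
by have:= lonesum_switch _ _ _ _ loneA Ail Ai'j; rewrite (negPf nAij) /= => ->.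
Qed.


(** * Deletion of zero columns *)

Definition supported {n k} (S : {set 'I_k}) (A : 'M[bool]_(n, k)) : Prop :=
  forall i j, A i j -> j \in S.

Definition restrict_cols {n k} (S : {set 'I_k}) (A : 'M[bool]_(n, k)) :
    'M[bool]_(n, #|S|) :=
  colsub enum_val A.

Definition extend_cols {n k} (S : {set 'I_k}) (M : 'M[bool]_(n, #|S|)) :
    'M[bool]_(n, k) :=
  \matrix_(i, j) [exists t, (enum_val t == j) && M i t].

Lemma extend_cols_supported {n k} (S : {set 'I_k}) (M : 'M[bool]_(n, #|S|)) :
  supported S (extend_cols S M).
Proof.
by move=> i j; rewrite mxE => /existsP[t /andP[/eqP<- _]]; apply: enum_valP.
Qed.

Lemma extend_colsK {n k} (S : {set 'I_k}) :
  cancel (@extend_cols n k S) (restrict_cols S).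
Proof.
move=> M; apply/matrixP => i t; rewrite !mxE.
apply/existsP/idP => [[t' /andP[/eqP/enum_val_inj->]] // | Mit].
by exists t; rewrite eqxx.
Qed.

Lemma restrict_colsK {n k} (S : {set 'I_k}) (A : 'M[bool]_(n, k)) :
  supported S A -> extend_cols S (restrict_cols S A) = A.
Proof.
move=> suppA; apply/matrixP => i j; rewrite mxE.
apply/existsP/idP => [[t] | Aij]; first by rewrite mxE => /andP[/eqP<-].
have Sj := suppA i j Aij; exists (enum_rank_in Sj j).
by rewrite mxE enum_rankK_in ?eqxx.
Qed.

Lemma row_sums_restrict {n k} (S : {set 'I_k}) (A : 'M[bool]_(n, k)) :
  supported S A -> row_sums (restrict_cols S A) = row_sums A.
Proof.
move=> suppA; apply/matrixP => i z; rewrite !mxE.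
rewrite [RHS](bigID (mem S)) /= [X in (_ + X)%N]big1 => [|j Sj]; last first.
  by case Aij: (A i j) => //; rewrite (suppA i j Aij) in Sj.
by rewrite addn0 [RHS]big_enum_val; apply: eq_bigr => t _; rewrite mxE.
Qed.

Lemma col_sums_restrict {n k} (S : {set 'I_k}) (A : 'M[bool]_(n, k)) :
  col_sums (restrict_cols S A) = colsub enum_val (col_sums A).
Proof.
by apply/matrixP => z t; rewrite !mxE; apply: eq_bigr => i _; rewrite mxE.
Qed.

Lemma supported_col_sums {n k} (S : {set 'I_k}) (A : 'M[bool]_(n, k)) :
  supported S A <-> forall j, j \notin S -> col_sums A 0 j = 0%N.
Proof.
split=> [suppA j Sj | zeroA i j Aij].
  rewrite mxE big1 // => i _; case Aij: (A i j) => //.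
  by rewrite (suppA i j Aij) in Sj.
apply: contraT => /zeroA; rewrite mxE => /eqP.
by rewrite sum_nat_eq0 => /forallP/(_ i); rewrite Aij.
Qed.

(** Two matrices with the same column sums vanish outside the same columns, so
    restriction and extension match the competitors of A with those of its
    restriction. *)
Lemma lonesum_restrict {n k} (S : {set 'I_k}) (A : 'M[bool]_(n, k)) :
  supported S A -> lonesum (restrict_cols S A) = lonesum A.
Proof.
move=> suppA; apply/lonesumP/lonesumP => uniqA A' rowE colE.
  have suppA' : supported S A'.
    by apply/supported_col_sums => j Sj; rewrite colE; move: j Sj; apply/supported_col_sums.
  rewrite -(restrict_colsK S A') // -(restrict_colsK S A) //; congr extend_cols.
  by apply: uniqA; rewrite ?row_sums_restrict // !col_sums_restrict colE.
have suppE := extend_cols_supported S A'.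
rewrite -[LHS]extend_colsK; congr restrict_cols; apply: uniqA.
  by rewrite -(row_sums_restrict S) // extend_colsK rowE row_sums_restrict.
apply/matrixP => z j; rewrite [z]ord1; have [Sj | nSj] := boolP (j \in S); last first.
  have /supported_col_sums-> // := suppE.
  by have /supported_col_sums-> := suppA.
have colEj (M : 'M[bool]_(n, k)) :
    col_sums M 0 j = col_sums (restrict_cols S M) 0 (enum_rank_in Sj j).
  by rewrite col_sums_restrict [RHS]mxE enum_rankK_in.
by rewrite !colEj extend_colsK colE.
Qed.

Definition col_support {n k} (A : 'M[bool]_(n, k)) : {set 'I_k} :=
  [set j | [exists i, A i j]].

Lemma col_support_supported {n k} (A : 'M[bool]_(n, k)) :
  supported (col_support A) A.
Proof. by move=> i j Aij; rewrite inE; apply/existsP; exists i. Qed.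

Lemma no_zero_col_restrict {n k} (A : 'M[bool]_(n, k)) :
  no_zero_col (restrict_cols (col_support A) A).
Proof.
apply/forallP => t; have:= enum_valP t; rewrite inE => /existsP[i Ait].
by apply/existsP; exists i; rewrite mxE.
Qed.

Lemma col_support_extend {n k} (S : {set 'I_k}) (M : 'M[bool]_(n, #|S|)) :
  no_zero_col M -> col_support (extend_cols S M) = S.
Proof.
move=> /forallP colM; apply/setP => j; rewrite inE; apply/existsP/idP => [[i] | Sj].
  exact: extend_cols_supported.
have /existsP[i Mij] := colM (enum_rank_in Sj j); exists i.
by rewrite mxE; apply/existsP; exists (enum_rank_in Sj j); rewrite enum_rankK_in ?eqxx.
Qed.

(** The predicate P lets the same count serve for all lonesum matrices and for
    those without zero rows. *)
Lemma card_by_col_support {n} (P : forall k, pred 'M[bool]_(n, k)) k :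
    (forall (S : {set 'I_k}) (A : 'M[bool]_(n, k)),
       supported S A -> P _ (restrict_cols S A) = P _ A) ->
  #|[set A : 'M[bool]_(n, k) | lonesum A && P k A]| =
    (\sum_(j < k.+1) 'C(k, j) *
       #|[set A : 'M[bool]_(n, j) | [&& lonesum A, no_zero_col A & P j A]]|)%N.
Proof.
move=> P_restrict.
pose F j := #|[set A : 'M[bool]_(n, j) | [&& lonesum A, no_zero_col A & P j A]]|.
have fiber (S : {set 'I_k}) :
    #|[set A : 'M[bool]_(n, k) | lonesum A && P k A & col_support A == S]| = F #|S|.
  rewrite /F -(card_imset _ (can_inj (@extend_colsK n k S))).
  congr #|pred_of_set _|; apply/setP => A; apply/idP/imsetP => [| [M M_in ->]].
    rewrite inE => /andP[/andP[loneA PA] /eqP suppA]; subst S.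
    have suppA := col_support_supported A.
    exists (restrict_cols (col_support A) A); last by rewrite restrict_colsK.
    by rewrite inE lonesum_restrict // no_zero_col_restrict P_restrict // loneA.
  move: M_in; rewrite !inE => /and3P[loneM colM PM].
  have suppM := extend_cols_supported S M.
  rewrite col_support_extend // eqxx andbT.
  by rewrite -(lonesum_restrict S) // -(P_restrict S) // extend_colsK loneM.
rewrite -sum1_card (partition_big col_support predT) //=.
under eq_bigr => S _.
  rewrite (eq_bigl [in [set A | lonesum A && P k A & col_support A == S]]); last first.
    by move=> A; rewrite !inE.
  rewrite sum1_card fiber; over.
rewrite (partition_big (fun S : {set 'I_k} => inord #|S| : 'I_k.+1) predT) //=.
apply: eq_bigr => j _.
rewrite (eq_bigl [in [set S : {set 'I_k} | #|S| == j]]); last first.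
  move=> S; rewrite inE -val_eqE /= inordK // ltnS.
  by rewrite -[k in (_ <= k)%N]card_ord max_card.
under eq_bigr => S do [rewrite inE => /eqP->].
by rewrite sum_nat_const card_draws card_ord.
Qed.

Lemma card_lonesum_by_cols n k :
  #|[set A : 'M[bool]_(n, k) | lonesum A]| =
    (\sum_(j < k.+1) 'C(k, j) * lonesumC n j)%N.
Proof.
have /= := @card_by_col_support n (fun _ => predT) k (fun _ _ _ => erefl).
under eq_finset => A do rewrite andbT.
move=> ->; apply: eq_bigr => j _; congr (_ * _)%N.
by apply: eq_card => A; rewrite !inE andbT.
Qed.

(** The matrices are transposed, so that their rows are what gets deleted. *)
Lemma lonesumC_sum n k :
  lonesumC n k = (\sum_(i < n.+1) 'C(n, i) * lonesumD i k)%N.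
Proof.
pose P j (A : 'M[bool]_(k, j)) := no_zero_col A^T.
have cardT m l (Q : pred 'M[bool]_(l, m)) :
    #|[set A : 'M[bool]_(m, l) | Q A^T]| = #|[set A | Q A]|.
  rewrite -(card_imset _ (@trmx_inj _ m l)); apply: eq_card => A.
  rewrite inE; apply/imsetP/idP => [[M] | QA]; first by rewrite inE => QM ->.
  by exists A^T; rewrite ?inE trmxK.
have P_restrict (S : {set 'I_n}) A : supported S A -> P _ (restrict_cols S A) = P _ A.
  move=> suppA; apply: eq_forallb => i; apply/existsP/existsP => [[t]|[j]].
    by rewrite !mxE => Ait; exists (enum_val t); rewrite mxE.
  rewrite mxE => Aij; have Sj := suppA i j Aij.
  by exists (enum_rank_in Sj j); rewrite !mxE enum_rankK_in.
have := card_by_col_support _ _ P_restrict.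
rewrite -cardT => cardE.
transitivity #|[set A : 'M[bool]_(n, k) | lonesum A^T && P n A^T]|.
  by apply: eq_card => A; rewrite !inE /P trmxK lonesum_tr.
rewrite cardE; apply: eq_bigr => i _; congr (_ * _)%N.
rewrite -cardT; apply: eq_card => A; rewrite !inE /P trmxK lonesum_tr.
congr (_ && _); rewrite andbC; congr (_ && _).
by apply: eq_forallb => l; apply: eq_existsb => r; rewrite mxE.
Qed.

(** The lonesum k x (n+1) matrices without zero column number C_{k,n+1}; those
    with a zero column are the transposed complements of the matrices counted by
    C_{n+1,k}. *)
Lemma lonesumC_add_swap n k :
  (lonesumC n.+1 k + lonesumC k n.+1 = #|[set A : 'M[bool]_(k, n.+1) | lonesum A]|)%N.
Proof.
pose flip (A : 'M[bool]_(n.+1, k)) := (compl_mx A)^T.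
have flipK : cancel flip (fun A => compl_mx A^T).
  by move=> A; rewrite /flip trmxK compl_mxK.
rewrite addnC -(cardsID [set A | no_zero_col A] [set A | lonesum A]).
congr (_ + _)%N; first by apply: eq_card => A; rewrite !inE.
rewrite /lonesumC -(card_imset _ (can_inj flipK)); apply: eq_card => A.
apply/imsetP/idP => [[M] | ]; rewrite !inE.
  move=> /andP[loneM colM] ->.
  by rewrite /flip -no_zero_col_compl // [no_zero_col M]colM lonesum_tr lonesum_compl.
move=> /andP[colA loneA]; exists (compl_mx A^T).
  rewrite inE lonesum_compl lonesum_tr loneA -[[forall _, _]]/(no_zero_col _).
  by rewrite no_zero_col_compl ?lonesum_compl ?lonesum_tr // compl_mxK trmxK.
by rewrite /flip compl_mxK trmxK.
Qed.

(** This is lonesumC_add_swap with the right-hand side sorted by nonzero columns: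
    the term j = n.+1 of the sum is lonesumC k n.+1 and cancels. *)
Lemma lonesumC_rec n k :
  lonesumC n.+1 k = (\sum_(j < n.+1) 'C(n.+1, j) * lonesumC k j)%N.
Proof.
apply: (@addIn (lonesumC k n.+1)).
by rewrite lonesumC_add_swap card_lonesum_by_cols big_ord_recr /= binn mul1n.
Qed.

Lemma lonesumCn0 n : lonesumC n 0 = 1%N.
Proof.
transitivity #|[set: 'M[bool]_(n, 0)]|; last by rewrite cardsT card_mx muln0.
apply: eq_card => A; rewrite !inE; apply/andP; split; last by apply/forallP => -[].
by apply/lonesumP => A' _ _; apply/matrixP => i [].
Qed.

Lemma lonesumC0k k : (0 < k)%N -> lonesumC 0 k = 0%N.
Proof.
case: k => // k _; apply: eq_card0 => A; rewrite inE; apply/andP => -[_].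
by move/forallP/(_ 0)/existsP=> -[[]].
Qed.

Lemma lonesumD0 k : (0 < k)%N -> lonesumD 0 k = 0%N.
Proof.
case: k => // k _; apply: eq_card0 => A; rewrite inE; apply/and3P => -[_ /forallP/(_ 0)].
by case/existsP=> -[].
Qed.

(** * The closed form *)

(** The number of surjections from a k-set onto an m-set, by the image of the
    last element, which is hit either by it alone or by others too. *)
Fixpoint surj (k m : nat) : nat :=
  match k, m with
  | 0, 0 => 1
  | k'.+1, m'.+1 => m'.+1 * (surj k' m' + surj k' m'.+1)
  | _, _ => 0
  end.

Lemma surj_small k m : (k < m)%N -> surj k m = 0%N.
Proof.
elim: k m => [|k IH] [|m] //; rewrite ltnS => lt_km /=.
by rewrite !IH ?muln0 // ltnW.
Qed.

Lemma sum_bin_succ n (F : nat -> nat) :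
  (\sum_(j < n.+2) 'C(n.+1, j) * F j =
   \sum_(j < n.+1) 'C(n, j) * F j + \sum_(j < n.+1) 'C(n, j) * F j.+1)%N.
Proof.
rewrite big_ord_recl bin0 mul1n /=.
under eq_bigr => j _ do rewrite /bump /= add1n binS mulnDl.
rewrite big_split /= addnA; congr addn.
rewrite big_ord_recr /= bin_small // addn0.
by rewrite [RHS]big_ord_recl bin0 mul1n.
Qed.

(** Both sides count the maps from an n-set to {0, .., m} that hit 1, .., m: on
    the left they are sorted by the elements not sent to 0. *)
Lemma sum_bin_surj n m :
  (\sum_(j < n.+1) 'C(n, j) * surj j m = surj n m + surj n m.+1)%N.
Proof.
elim: n m => [|n IH] m; first by rewrite big_ord1 bin0 mul1n; case: m.
rewrite (sum_bin_succ n (surj^~ m)) IH; case: m => [|m] /=.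
  by rewrite big1 => [|j _]; rewrite ?muln0 // addn0 add0n mul1n.
under eq_bigr => j _ do rewrite mulnCA mulnDr.
by rewrite -big_distrr big_split /= !IH; lia.
Qed.

(** Omitting j = n.+1 forces the value 0 to be taken. *)
Lemma sum_bin_surj_lt n m :
  (\sum_(j < n.+1) 'C(n.+1, j) * surj j m = surj n.+1 m.+1)%N.
Proof.
apply: (@addnI (surj n.+1 m)).
by rewrite -sum_bin_surj [RHS]big_ord_recr /= binn mul1n addnC.
Qed.

(** The number of chains A_1 < .. < A_m of distinct nonempty subsets of an
    n-set: sending x to i when A_i is the first member containing x, and to 0
    when there is none, yields the maps to {0, .., m} that hit 1, .., m; the two
    terms are the cases where 0 is missed and where it is hit. *)
Definition chains n m := (surj n m + surj n m.+1)%N.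

(** The number of maps from a k-set to the nonempty subsets of an n-set whose
    image is a chain, sorted by the length m of that chain; these are the k
    columns of a lonesum matrix without zero column.  Terms with m > k vanish. *)
Definition chain_sum n k := (\sum_(m < k.+1) chains n m * surj k m)%N.

Lemma chain_sumE N n k : (k <= N)%N ->
  chain_sum n k = (\sum_(m < N.+1) chains n m * surj k m)%N.
Proof.
move=> le_kN; rewrite /chain_sum (big_ord_widen N.+1 (fun m => chains n m * surj k m)%N) //.
rewrite big_mkcond; apply: eq_bigr => m _; rewrite ltnS; case: leqP => // lt_km.
by rewrite surj_small ?muln0.
Qed.

Lemma sum_bin_chain_sum n k :
  (\sum_(j < k.+1) 'C(k.+1, j) * chain_sum n j =
   \sum_(m < k.+1) m.+1 * (chains n m * chains k m))%N.
Proof.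
under eq_bigr => j _ do rewrite (chain_sumE k) -1?ltnS // big_distrr.
rewrite exchange_big; apply: eq_bigr => m _ /=.
under eq_bigr => j _ do rewrite mulnCA.
by rewrite -big_distrr sum_bin_surj_lt /chains /=; lia.
Qed.

(** Since surj n.+1 m.+1 is m.+1 * chains n m, splitting chains n.+1 m into its two
    terms and shifting the index in the first one collects
    m.+1 * chains n m * (surj k m + surj k m.+1). *)
Lemma chain_sumS n k :
  chain_sum n.+1 k = (\sum_(m < k.+1) m.+1 * (chains n m * chains k m))%N.
Proof.
rewrite /chain_sum; under eq_bigr => m _ do rewrite /chains mulnDl addnC.
rewrite big_split /= [X in (_ + X)%N]big_ord_recl /= mul0n add0n.
have -> : (\sum_(m < k) surj n.+1 (bump 0 m) * surj k (bump 0 m) =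
           \sum_(m < k.+1) surj n.+1 m.+1 * surj k m.+1)%N.
  by rewrite [RHS]big_ord_recr (@surj_small k k.+1) // muln0 [RHS]addn0.
by rewrite -big_split; apply: eq_bigr => m _; rewrite /= -mulnDr -mulnA.
Qed.

Lemma chain_sum_sym n k :
  (\sum_(m < k.+1) m.+1 * (chains n m * chains k m) =
   \sum_(m < n.+1) m.+1 * (chains k m * chains n m))%N.
Proof.
wlog le_nk: n k / (n <= k)%N => [sym|].
  by case/orP: (leq_total n k) => /sym.
rewrite [RHS](big_ord_widen k.+1 (fun m => m.+1 * (chains k m * chains n m))%N) //.
rewrite [RHS]big_mkcond; apply: eq_bigr => m _ /=; rewrite ltnS.
case: leqP => [_|lt_nm]; first by rewrite (mulnC (chains n m)).
by rewrite {1}/chains !surj_small ?muln0 // ltnW.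
Qed.

Lemma chain_sum_rec_left n k :
  (\sum_(j < n.+1) 'C(n.+1, j) * chain_sum k j = chain_sum n.+1 k)%N.
Proof. by rewrite sum_bin_chain_sum chain_sumS chain_sum_sym. Qed.

Lemma chain_sum_rec_right n k :
  (\sum_(j < k.+1) 'C(k.+1, j) * chain_sum n j = chain_sum n.+1 k)%N.
Proof. by rewrite sum_bin_chain_sum chain_sumS. Qed.

Lemma chain_sum0 k : chain_sum 0 k = (k == 0)%N.
Proof.
rewrite /chain_sum big_ord_recl big1 => [|m _]; last by rewrite mul0n.
by rewrite addn0; case: k.
Qed.

(** * Coefficients of the powers of 1 - exp (- x) *)

Local Notation u := one_sub_expN.

Definition fps_deriv (f : fps) : fps := fun n => n.+1%:R * f n.+1.

Lemma fps_deriv_mul (f g : fps) n :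
  fps_deriv (fps_mul f g) n =
  fps_mul (fps_deriv f) g n + fps_mul f (fps_deriv g) n.
Proof.
have ->: fps_deriv (fps_mul f g) n =
   \sum_(i < n.+2) i%:R * f i * g (n.+1 - i)%N
   + \sum_(i < n.+2) f i * ((n.+1 - i)%:R * g (n.+1 - i)%N).
  rewrite /fps_deriv /fps_mul mulr_sumr -big_split; apply: eq_bigr => i _ /=.
  by rewrite -{1}(subnK (ltnSE (ltn_ord i))) natrD; ring.
congr (_ + _).
  by rewrite big_ord_recl !mul0r add0r; apply: eq_bigr => i _; rewrite subSS.
rewrite big_ord_recr /= subnn mul0r mulr0 addr0; apply: eq_bigr => i _.
by rewrite subSn // -ltnS.
Qed.

Lemma fact_neq0 m : (m`!)%:R != 0 :> rat.
Proof. by rewrite Num.Theory.pnatr_eq0 -lt0n fact_gt0. Qed.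

Lemma one_sub_expN_deriv n : fps_deriv u n = fps_one n - u n.
Proof.
rewrite /fps_deriv /fps_one /= factS natrM exprS.
case: n => [|n] /=; first by [].
by field; rewrite fact_neq0 -natrD Num.Theory.pnatr_eq0.
Qed.

Lemma fps_mul1l f n : fps_mul fps_one f n = f n.
Proof.
rewrite /fps_mul big_ord_recl mul1r subn0 big1 ?addr0 // => i _.
by rewrite mul0r.
Qed.

(** The chain rule with u' = 1 - u; for i = 0 the factor i absorbs the truncated
    exponent. *)
Lemma fps_exp_deriv i n :
  fps_deriv (fps_exp u i) n = i%:R * (fps_exp u i.-1 n - fps_exp u i n).
Proof.
elim: i n => [|i IH] n; first by rewrite mul0r /fps_deriv mulr0.
rewrite [fps_exp u i.+1]/(fps_mul u (fps_exp u i)) fps_deriv_mul.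
have ->: fps_mul (fps_deriv u) (fps_exp u i) n =
    fps_exp u i n - fps_exp u i.+1 n.
  rewrite -[in X in X - _](fps_mul1l (fps_exp u i)) /fps_mul -sumrB.
  by apply: eq_bigr => a _; rewrite one_sub_expN_deriv mulrBl.
have ->: fps_mul u (fps_deriv (fps_exp u i)) n =
    i%:R * (fps_mul u (fps_exp u i.-1) n - fps_exp u i.+1 n).
  rewrite -sumrB mulr_sumr; apply: eq_bigr => a _; by rewrite IH mulrCA mulrBr.
case: i {IH} => [|i]; first by rewrite !mul0r mul1r addr0.
rewrite (_ : fps_mul u (fps_exp u i.+1.-1) n = fps_exp u i.+1 n) //.
by rewrite -[i.+2%:R]natr1 mulrDl mul1r addrC.
Qed.

Lemma fps_exp_rec i n :
  n.+1%:R * fps_exp u i.+1 n.+1 = i.+1%:R * (fps_exp u i n - fps_exp u i.+1 n).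
Proof. exact: fps_exp_deriv. Qed.

(** * Poly-Bernoulli numbers as moments *)

(** n! [x^n] sum_i i^k u^i, with 0^0 = 1. *)
Definition moment n k : rat := n`!%:R * fps_comp (fun i => (i ^ k)%:R) u n.

Lemma fps_comp_widen N (f : fps) n : (n <= N)%N ->
  fps_comp f u n = \sum_(i < N.+1) f i * fps_exp u i n.
Proof.
move=> le_nN; rewrite /fps_comp (big_ord_widen N.+1 (fun i => f i * fps_exp u i n)) //.
rewrite big_mkcond; apply: eq_bigr => i _; rewrite ltnS; case: leqP => // lt_ni.
by rewrite fps_exp_lt ?mulr0.
Qed.

Lemma expSn_bin i k :
  ((i.+1 ^ k)%:R = \sum_(j < k.+1) 'C(k, j)%:R * (i ^ j)%:R :> rat).
Proof.
rewrite -add1n Pascal natr_sum; apply: eq_bigr => j _.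
by rewrite exp1n mul1n natrM.
Qed.

Lemma moment0 k : moment 0 k = (k == 0)%N%:R.
Proof.
by rewrite /moment /fps_comp big_ord1 mul1r mulr1; case: k => // k; rewrite exp0n.
Qed.

(** From (u^(i+1))' = (i + 1) (u^i - u^(i+1)), summation by parts turns the
    derivative of sum_i i^k u^i into sum_i ((i + 1)^(k+1) - i^(k+1)) u^i. *)
Lemma moment_rec n k :
  moment n.+1 k = \sum_(j < k.+1) 'C(k.+1, j)%:R * moment n j.
Proof.
rewrite /moment factS natrM (mulrC n.+1%:R) -mulrA.
under eq_bigr => j _ do rewrite mulrCA.
rewrite -mulr_sumr; congr (_ * _).
have ->: n.+1%:R * fps_comp (fun i => (i ^ k)%:R) u n.+1 =
    \sum_(i < n.+1) (i.+1 ^ k.+1)%:R * (fps_exp u i n - fps_exp u i.+1 n).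
  rewrite /fps_comp big_ord_recl mulr0 add0r mulr_sumr.
  apply: eq_bigr => i _; rewrite mulrCA fps_exp_rec mulrA -natrM.
  by rewrite lift0 mulnC -expnS.
under eq_bigr => i _ do rewrite mulrBr.
rewrite sumrB.
have ->: \sum_(i < n.+1) (i.+1 ^ k.+1)%:R * fps_exp u i.+1 n =
    \sum_(i < n.+1) (i ^ k.+1)%:R * fps_exp u i n.
  rewrite big_ord_recr [RHS]big_ord_recl (@fps_exp_lt u n.+1) // mulr0 [LHS]addr0.
  by rewrite exp0n // mul0r add0r.
rewrite -sumrB; under [RHS]eq_bigr => j _ do rewrite mulr_sumr.
rewrite [RHS]exchange_big; apply: eq_bigr => i _ /=.
rewrite expSn_bin big_ord_recr /= binn mul1r mulrDl addrK mulr_suml.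
by apply: eq_bigr => j _; rewrite mulrA.
Qed.

Lemma moment_chain_sum n k : moment n k = (chain_sum n k)%:R.
Proof.
elim: n k => [|n IH] k; first by rewrite moment0 chain_sum0.
rewrite moment_rec -chain_sum_rec_right natr_sum.
by apply: eq_bigr => j _; rewrite natrM IH.
Qed.

(** Dividing by u shifts the summation index of the polylogarithm; by uniqueness
    it is enough to multiply back. *)
Lemma poly_bernoulli_moment (B : nat -> nat -> rat) n k :
  is_poly_bernoulli B -> B n k = \sum_(j < k.+1) 'C(k, j)%:R * moment n j.
Proof.
move=> hB; transitivity (n`!%:R * fps_comp (fun i => (i.+1 ^ k)%:R) u n); last first.
  under eq_bigr => j _ do rewrite mulrCA.
  rewrite -mulr_sumr; congr (_ * _).
  under eq_bigr => j _ do rewrite mulr_sumr.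
  rewrite exchange_big; apply: eq_bigr => i _ /=.
  by rewrite expSn_bin mulr_suml; apply: eq_bigr => j _; rewrite mulrA.
apply: (poly_bernoulli_unique hB (B' := fun n k =>
  n`!%:R * fps_comp (fun i => (i.+1 ^ k)%:R) u n)) => {}k {}n.
transitivity (\sum_(i < n.+1) (i.+1 ^ k)%:R * fps_exp u i.+1 n); last first.
  rewrite /fps_comp [RHS]big_ord_recl mul0r add0r big_ord_recr.
  by rewrite (@fps_exp_lt u n.+1) // mulr0 [LHS]addr0.
rewrite /fps_mul.
under eq_bigr => a _.
  rewrite /egf [a`!%:R * _]mulrC mulfK ?fact_neq0 //.
  rewrite (fps_comp_widen n) -1?ltnS // mulr_suml; over.
rewrite exchange_big; apply: eq_bigr => i _ /=.
rewrite fps_mulC mulr_sumr.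
by apply: eq_bigr => a _; rewrite mulrA.
Qed.

(** * The relations between the three families *)

Lemma lonesumC_chain_sum n k : lonesumC n k = chain_sum n k.
Proof.
have [N] := ubnP (n + k); elim: N n k => // N IH [|n] k lt_nkN.
  rewrite chain_sum0; case: k {lt_nkN} => [|k]; first exact: lonesumCn0.
  exact: lonesumC0k.
rewrite lonesumC_rec -chain_sum_rec_left; apply: eq_bigr => j _.
by rewrite IH //; have := ltn_ord j; lia.
Qed.

Lemma poly_bernoulli_lonesumC (B : nat -> nat -> rat) n k :
  is_poly_bernoulli B ->
  B n k = \sum_(0 <= j < k.+1) 'C(k, j)%:R * (lonesumC n j)%:R.
Proof.
move=> hB; rewrite (poly_bernoulli_moment _ _ _ hB) big_mkord.
by apply: eq_bigr => j _; rewrite moment_chain_sum lonesumC_chain_sum.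
Qed.

Theorem mainTheorem2 (B : nat -> nat -> rat) (hB : is_poly_bernoulli B) :
  [/\ forall n k : nat, (1 <= n)%N ->
        B n k = 1 + \sum_(1 <= i < k.+1) 'C(k, i)%:R * (lonesumC n i)%:R
        /\ B n k = \sum_(0 <= i < k.+1) 'C(k, i)%:R * (lonesumC n i)%:R,
      forall n k : nat, (1 <= n)%N -> (1 <= k)%N ->
        lonesumC n k = (\sum_(1 <= i < n.+1) 'C(n, i) * lonesumD i k)%N
    & forall n k : nat, (1 <= n)%N -> (1 <= k)%N ->
        B n k = 1 + \sum_(1 <= i < n.+1) \sum_(1 <= j < k.+1)
                      'C(n, i)%:R * 'C(k, j)%:R * (lonesumD i j)%:R].
Proof.
have lonesumC_D n k : (1 <= k)%N ->
    lonesumC n k = (\sum_(1 <= i < n.+1) 'C(n, i) * lonesumD i k)%N.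
  move=> k_gt0; rewrite lonesumC_sum -(big_mkord predT (fun i => 'C(n, i) * lonesumD i k)%N).
  by rewrite [LHS]big_ltn // lonesumD0 // muln0.
have BC n k : B n k = 1 + \sum_(1 <= i < k.+1) 'C(k, i)%:R * (lonesumC n i)%:R.
  by rewrite poly_bernoulli_lonesumC // big_ltn // bin0 lonesumCn0 mul1r.
split=> [n k _ | n k _ | n k _ _]; last 1 first.
- rewrite BC exchange_big_nat; congr (_ + _).
  apply: eq_big_nat => j /andP[j_gt0 _]; rewrite lonesumC_D // natr_sum mulr_sumr.
  by apply: eq_bigr => i _; rewrite natrM mulrCA mulrA.
- by split; [exact: BC | exact: poly_bernoulli_lonesumC].
- exact: lonesumC_D.
Qed.
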